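(* Let $r\ge 3$ be a fixed integer and let $p_*=\frac{r-1}{r}$. There exist constants $\eta_0(r)>0$ and $C(r)>0$, depending only on $r$, such that the following holds for all $0<\eta\le\eta_0(r)$ and all $n\ge 1$. Let $\mathcal A_1,\dots,\mathcal A_r\subseteq 2^{[n]}$ be $r$-cross-intersecting. If $$\sum_{i=1}^r\mu_{p_*}(\mathcal A_i)\ge r-1-\eta,$$ then one of the following alternatives holds. (i) There exists $j\in[n]$ such that $\mu_{p_*}(\mathcal A_i\,\Delta\,\mathcal S_j)\le C(r)\eta$ for every $i\in[r]$. (ii) There exists a unique index $i\in[r]$ such that $\mu_{p_*}(\mathcal A_i)\le C(r)\eta$ and, for every $j\in[r]\setminus\{i\}$, $\mu_{p_*}(\mathcal A_j)\ge 1-C(r)\eta$.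
   Context: $[n]=\{1,\dots,n\}$ and $2^{[n]}$ is its power set. For $0\le p\le 1$ and $\mathcal F\subseteq 2^{[n]}$, the $p$-biased measure is $\mu_p(\mathcal F)=\sum_{F\in\mathcal F}p^{|F|}(1-p)^{n-|F|}$. Families $\mathcal A_1,\dots,\mathcal A_r\subseteq 2^{[n]}$ are $r$-cross-intersecting if $A_1\cap\cdots\cap A_r\neq\varnothing$ for every choice of $A_i\in\mathcal A_i$, $i\in[r]$ (vacuously true if some $\mathcal A_i$ is empty). For $j\in[n]$, the $1$-star is $\mathcal S_j=\{A\subseteq[n]: j\in A\}$. $\mathcal F\Delta\mathcal G=(\mathcal F\setminus\mathcal G)\cup(\mathcal G\setminus\mathcal F)$ is the symmetric difference. *)

(* Defs.v *)
From HB Require Import structures.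
From mathcomp Require Import all_boot all_order all_algebra.
From mathcomp Require Import reals.

Set Implicit Arguments.
Unset Strict Implicit.
Unset Printing Implicit Defensive.

Import Order.TTheory GRing.Theory Num.Theory.
Local Open Scope ring_scope.

(* The ground set [n] is modelled by 'I_n, i.e. shifted to {0, ..., n-1}. *)

(* The truncated subtraction n - #|A| is exact because #|A| <= n. *)
Definition biased_measure (R : realType) (n : nat) (p : R)
    (F : {set {set 'I_n}}) : R :=
  \sum_(A in F) p ^+ #|A| * (1 - p) ^+ (n - #|A|).

Definition cross_intersecting (r n : nat) (A : 'I_r -> {set {set 'I_n}}) : Prop :=
  forall B : 'I_r -> {set 'I_n},
    (forall i, B i \in A i) -> \bigcap_(i < r) B i != set0.

Definition star (n : nat) (j : 'I_n) : {set {set 'I_n}} :=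
  [set A : {set 'I_n} | j \in A].

Definition symdiff (T : finType) (F G : {set T}) : {set T} :=
  (F :\: G) :|: (G :\: F).

Definition pstar (R : realType) (r : nat) : R := (r%:R - 1) / r%:R.

(* Main.v *)
(** Color every point of the ground set independently and uniformly with r colors,
    and let D_i be the i-th color class. The complement of D_i is p_*-biased, and
    these complements have empty intersection, so the events
    h_i := "the complement of D_i is not in A_i" cover the whole space, while
    their probabilities a_i add up to at most 1 + eta.

    Expand each h_i in the characters chi_S of the 1/r-biased cube. The variance
    of the sum of the h_i is O(eta), and for each S it dominates the form
    (r-1)^k (x_i^2 + x_j^2) + 2 (r-1) (-1)^k x_i x_j with k = #|S| >= 1, whose
    total over S, up to the terms E h_i h_j = O(eta), is
    a_i (1 - a_i) + a_j (1 - a_j) - 2 (r-1) a_i a_j. These relations force either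
    some a_k >= 1 - O(eta) or all a_i = 1/r + O(eta), with no smallness assumption
    on eta.

    In the second case, fix the color of one relevant point y so that eta does not
    increase, and argue by induction on the number of relevant points. If the
    restricted families are close to the star of x, then fixing the color of x
    instead moves some a_i far from 1/r; if they are close to constants, fixing
    the color of y does. In both cases the dichotomy, applied to the restrictions
    at that single point, shows that the families are O(eta)-close to its star. *)
Require Import Defs.
From HB Require Import structures.
From mathcomp Require Import all_boot all_order all_algebra.
From mathcomp Require Import reals.
From mathcomp Require Import ring lra.
Import Order.TTheory GRing.Theory Num.Theory.
Local Open Scope ring_scope.

Set Implicit Arguments.
Unset Strict Implicit.
Unset Printing Implicit Defensive.

(** * Uniform random colorings and characters of the [1/r]-biased cube *)

Section Coloring.
Variables (R : realFieldType) (T : finType) (r : nat).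

Definition color_class (c : {ffun T -> 'I_r}) (i : 'I_r) : {set T} :=
  [set x | c x == i].

Definition expect (F : {ffun T -> 'I_r} -> R) : R :=
  \sum_c r%:R^-1 ^+ #|T| * F c.

Lemma eq_expect F G : F =1 G -> expect F = expect G.
Proof. by move=> FG; apply: eq_bigr => c _; rewrite FG. Qed.

Lemma expectD F G : expect (fun c => F c + G c) = expect F + expect G.
Proof. by rewrite -big_split; apply: eq_bigr => c _; rewrite mulrDr. Qed.

Lemma expectZ a F : expect (fun c => a * F c) = a * expect F.
Proof. by rewrite mulr_sumr; apply: eq_bigr => c _; rewrite mulrCA. Qed.

Lemma expect_sum (I : finType) (P : pred I) (F : I -> {ffun T -> 'I_r} -> R) :
  expect (fun c => \sum_(i | P i) F i c) = \sum_(i | P i) expect (F i).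
Proof. by rewrite exchange_big; apply: eq_bigr => c _; rewrite mulr_sumr. Qed.

Lemma ler_expect F G : (forall c, F c <= G c) -> expect F <= expect G.
Proof.
by move=> FG; apply: ler_sum => c _; rewrite ler_wpM2l ?exprn_ge0 ?invr_ge0.
Qed.

Lemma expect_prod (f : T -> 'I_r -> R) :
  expect (fun c => \prod_x f x (c x)) = \prod_x (r%:R^-1 * \sum_k f x k).
Proof.
by rewrite big_split /= prodr_const cardE -cardT bigA_distr_bigA mulr_sumr.
Qed.

Hypothesis r_gt0 : (0 < r)%N.

Lemma expect_const a : expect (fun=> a) = a.
Proof.
have r0 : r%:R != 0 :> R by rewrite pnatr_eq0 -lt0n.
have := expect_prod (fun _ _ => 1); rewrite [RHS]big1; last first.
  by move=> x _; rewrite sumr_const card_ord mulVf.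
under eq_expect do rewrite big1 //.
by move=> E; rewrite -[RHS]mulr1 -E -expectZ; apply: eq_expect => c; rewrite mulr1.
Qed.

Definition recolor (c : {ffun T -> 'I_r}) (x : T) (k : 'I_r) : {ffun T -> 'I_r} :=
  [ffun y => if y == x then k else c y].

(** Resampling one point preserves the uniform measure: swapping the color at [x] with an
    independent fresh color is an involution on pairs. *)
Lemma expect_recolor (x : T) F :
  expect F = r%:R^-1 * \sum_k expect (fun c => F (recolor c x k)).
Proof.
have r0 : r%:R != 0 :> R by rewrite pnatr_eq0 -lt0n.
pose s (u : {ffun T -> 'I_r} * 'I_r) := (recolor u.1 x u.2, u.1 x).
have sK : involutive s.
  case=> c k; rewrite /s /=; congr pair; last by rewrite ffunE eqxx.
  by apply/ffunP => y; rewrite !ffunE; case: eqP => [->|].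
rewrite exchange_big pair_big /=.
rewrite (reindex_inj (inv_inj sK)).
under eq_bigr => u _ do rewrite -[recolor _ _ _]/(s (s u)).1 sK.
rewrite -(pair_big xpredT xpredT (fun c _ => r%:R^-1 ^+ #|T| * F c)) /=.
rewrite mulr_sumr; apply: eq_bigr => c _.
by rewrite sumr_const card_ord -(mulr_natl (_ * _)) mulKf.
Qed.

Lemma color_class_recolor c x k i :
  color_class (recolor c x k) i =
  if i == k then x |: color_class c i else color_class c i :\ x.
Proof.
apply/setP => y; case: (eqVneq i k) => [->|ik]; rewrite !inE ffunE;
  case: (eqVneq y x) => //= _; rewrite ?eqxx //.
by rewrite eq_sym (negPf ik).
Qed.

(** Unnormalized character: on a color class each factor has mean 0 and second moment [r - 1], so no
    square roots appear. *)
Definition chi (S D : {set T}) : R := \prod_(x in S) (r%:R * (x \in D)%:R - 1).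

Lemma chi_set0 D : chi set0 D = 1.
Proof. by rewrite /chi big_set0. Qed.

(** The expectation factors over points. A point in exactly one of [S], [S'] contributes a mean,
    which is 0; a point in both contributes the second moment [r - 1] if [i = j], and [-1] otherwise
    because distinct classes are disjoint. *)
Lemma expect_chiM (i j : 'I_r) (S S' : {set T}) :
  expect (fun c => chi S (color_class c i) * chi S' (color_class c j)) =
  (S == S')%:R * (if i == j then r%:R - 1 else -1) ^+ #|S|.
Proof.
have r0 : r%:R != 0 :> R by rewrite pnatr_eq0 -lt0n.
have sum_ind k : \sum_(l < r) ((l == k)%:R : R) = 1.
  by rewrite (bigD1 k) //= eqxx big1 ?addr0 // => l /negPf ->.
pose f x k : R := (if x \in S then r%:R * (k == i)%:R - 1 else 1) *
                  (if x \in S' then r%:R * (k == j)%:R - 1 else 1).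
transitivity (expect (fun c => \prod_x f x (c x))).
  apply: eq_expect => c; rewrite /chi /f big_split /=.
  by congr (_ * _); rewrite big_mkcond /=; apply: eq_bigr => x _; rewrite inE.
rewrite expect_prod.
have E x : r%:R^-1 * \sum_k f x k =
    if x \in S then
      if x \in S' then (if i == j then r%:R - 1 else -1) else 0
    else if x \in S' then 0 else 1.
  rewrite /f; case: (x \in S); case: (x \in S').
  - have sum_ind2 : \sum_k ((k == i)%:R * (k == j)%:R) = (i == j)%:R :> R.
      rewrite (bigD1 i) //= eqxx mul1r big1 ?addr0 // => k /negPf ->.
      by rewrite mul0r.
    rewrite (eq_bigr (fun k => r%:R ^+ 2 * ((k == i)%:R * (k == j)%:R) -
      (r%:R * (k == i)%:R + r%:R * (k == j)%:R) + 1)); last by move=> k _; ring.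
    rewrite big_split sumrB big_split /= -!mulr_sumr !sum_ind sum_ind2.
    by rewrite sumr_const card_ord; case: eqP => _ /=; field.
  - under eq_bigr => k _ do rewrite mulr1.
    by rewrite sumrB -mulr_sumr sum_ind sumr_const card_ord mulr1 subrr mulr0.
  - under eq_bigr => k _ do rewrite mul1r.
    by rewrite sumrB -mulr_sumr sum_ind sumr_const card_ord mulr1 subrr mulr0.
  - under eq_bigr => k _ do rewrite mulr1.
    by rewrite sumr_const card_ord mulVf.
rewrite (eq_bigr _ (fun x _ => E x)).
case: (eqVneq S) => [<-|neq].
  rewrite mul1r -prodr_const [RHS]big_mkcond /=.
  by apply: eq_bigr => x _; case: (x \in S).
rewrite mul0r; apply/eqP; apply: contraNT neq => /prodf_neq0 nz.
by apply/eqP/setP => x; move: (nz x isT); case: (x \in S); case: (x \in S');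
  rewrite ?eqxx.
Qed.

Lemma chi_span (h : {set T} -> R) :
  exists a : {set T} -> R, forall D, h D = \sum_(S : {set T}) a S * chi S D.
Proof.
have r0 : r%:R != 0 :> R by rewrite pnatr_eq0 -lt0n.
(* Agreement of [D] and [D'] at [x] is affine in the character factor, with slope [w D' x] and
   constant term [u D' x]; expanding the product over [x] writes the point mass at [D'] in
   characters. *)
pose w (D : {set T}) x : R := if x \in D then r%:R^-1 else - r%:R^-1.
pose u (D : {set T}) x : R := if x \in D then r%:R^-1 else 1 - r%:R^-1.
exists (fun S : {set T} =>
  \sum_(D' : {set T}) h D' * \prod_x (if x \in S then w D' x else u D' x)).
move=> D.
have E (D' : {set T}) : (D == D')%:R =
    \sum_(S : {set T}) (\prod_x (if x \in S then w D' x else u D' x)) * chi S D.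
  transitivity (\prod_x (w D' x * (r%:R * (x \in D)%:R - 1) + u D' x)).
    have F x : w D' x * (r%:R * (x \in D)%:R - 1) + u D' x =
        ((x \in D) == (x \in D'))%:R.
      by rewrite /w /u; case: (x \in D); case: (x \in D') => /=; field.
    under [RHS]eq_bigr do rewrite F.
    case: (eqVneq D) => [->|neq]; first by rewrite big1 // => x _; rewrite eqxx.
    apply/esym/eqP; apply: contraNT neq => /prodf_neq0 nz.
    apply/eqP/setP => x; move: (nz x isT).
    by case: (x \in D); case: (x \in D'); rewrite ?eqxx.
  rewrite bigA_distr /=; apply: eq_bigr => S _.
  rewrite /chi [X in _ = _ * X]big_mkcond /= -big_split /=; apply: eq_bigr => x _.
  by case: (x \in S); rewrite ?mulr1.
under eq_bigr do rewrite mulr_suml.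
rewrite exchange_big /= (bigD1 D) //=.
under eq_bigr do rewrite -mulrA.
rewrite -mulr_sumr -E eqxx mulr1 big1 ?addr0 // => D' neq.
under eq_bigr do rewrite -mulrA.
by rewrite -mulr_sumr -E eq_sym (negPf neq) mulr0.
Qed.

Lemma expect_chi_expansion (i j : 'I_r) (a b : {set T} -> R) :
  expect (fun c => (\sum_(S : {set T}) a S * chi S (color_class c i)) *
                   (\sum_(S : {set T}) b S * chi S (color_class c j))) =
  \sum_(S : {set T}) a S * b S * (if i == j then r%:R - 1 else -1) ^+ #|S|.
Proof.
under eq_expect do rewrite big_distrlr /=.
rewrite expect_sum; apply: eq_bigr => S _.
rewrite expect_sum (bigD1 S) //= [X in _ + X]big1 ?addr0 => [|S' neq].
  under eq_expect do rewrite mulrACA.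
  by rewrite expectZ expect_chiM eqxx mul1r.
under eq_expect do rewrite mulrACA.
by rewrite expectZ expect_chiM eq_sym (negPf neq) mul0r mulr0.
Qed.

Lemma expect_chi_mean (i : 'I_r) (a : {set T} -> R) :
  expect (fun c => \sum_(S : {set T}) a S * chi S (color_class c i)) = a set0.
Proof.
(* The second expansion is that of the constant 1, which is [chi set0]. *)
have := expect_chi_expansion i i a (fun S => (S == set0)%:R).
rewrite (bigD1 set0) //= [X in _ = _ + X]big1 ?addr0 => [|S /negPf ->]; last first.
  by rewrite mulr0 mul0r.
rewrite eqxx cards0 !mulr1 => <-; apply: eq_expect => c.
rewrite [X in _ * X](bigD1 set0) //= [X in _ + X]big1 => [|S /negPf ->].
  by rewrite chi_set0 eqxx !mulr1 addr0 mulr1.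
by rewrite mul0r.
Qed.

End Coloring.

(** * Quadratic forms attached to a single frequency *)

Section QuadraticForm.
Variables (R : realFieldType) (r : nat).
Implicit Type a : 'I_r -> R.

(** The right side is [r] times the sum of squared deviations from the mean; the terms [i] and [j]
    alone give at least half of [(a i - a j) ^+ 2]. *)
Lemma sum_sqr_deviation a (i j : 'I_r) : i != j ->
  r%:R / 2 * (a i - a j) ^+ 2 <= r%:R * \sum_l a l ^+ 2 - (\sum_l a l) ^+ 2.
Proof.
move=> ij.
have r_gt0 : 0 < r%:R :> R by rewrite ltr0n (leq_ltn_trans _ (ltn_ord i)).
set s := \sum_l a l; pose m := s / r%:R.
have -> : r%:R * \sum_l a l ^+ 2 - s ^+ 2 = r%:R * \sum_l (a l - m) ^+ 2.
  rewrite [X in _ = _ * X](eq_bigr (fun l => a l ^+ 2 - 2 * m * a l + m ^+ 2)); last first.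
    by move=> l _ /=; ring.
  rewrite big_split sumrB /= -mulr_sumr sumr_const card_ord -/s.
  by rewrite -(mulr_natl (m ^+ 2)) /m; field; rewrite gt_eqF.
rewrite (bigD1 i) //= (bigD1 j) 1?eq_sym //=.
have rest : 0 <= \sum_(l < r | (l != i) && (l != j)) (a l - m) ^+ 2.
  by apply: sumr_ge0 => l _; rewrite sqr_ge0.
rewrite -mulrA ler_pM2l //.
have := sqr_ge0 (a i + a j - 2 * m); nra.
Qed.

Lemma sum_form (x y : R) a :
  \sum_i \sum_j a i * a j * (if i == j then x else y) =
  (x - y) * (\sum_i a i ^+ 2) + y * (\sum_i a i) ^+ 2.
Proof.
rewrite [in RHS]expr2 big_distrlr !mulr_sumr -big_split /=.
apply: eq_bigr => i _; rewrite mulr_sumr (bigD1 i) //= eqxx.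
rewrite [in RHS](bigD1 i) //= (eq_bigr (fun j => y * (a i * a j))); first by ring.
by move=> j; rewrite eq_sym => /negPf -> /=; ring.
Qed.

Hypothesis r_ge3 : (3 <= r)%N.

(* For k = 1 both sides vanish exactly when all a i coincide; for k >= 2 the
   diagonal weight (r - 1) ^+ k dominates. *)
Lemma pair_form_le a (i j : 'I_r) (k : nat) : i != j -> (0 < k)%N ->
  (r%:R - 1) ^+ k * (a i ^+ 2 + a j ^+ 2)
    + 2 * (r%:R - 1) * ((-1) ^+ k * (a i * a j))
  <= 4 * \sum_l \sum_m
       a l * a m * (if l == m then r%:R - 1 else -1) ^+ k.
Proof.
move=> ij k_gt0.
have r3 : 3 <= r%:R :> R by rewrite ler_nat.
rewrite (eq_bigr (fun l => \sum_m
  a l * a m * (if l == m then (r%:R - 1) ^+ k else (-1) ^+ k))); last first.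
  by move=> l _; apply: eq_bigr => m _; case: eqP.
rewrite sum_form.
have dev := sum_sqr_deviation a ij.
have q_le : a i ^+ 2 + a j ^+ 2 <= \sum_l a l ^+ 2.
  rewrite (bigD1 i) //= (bigD1 j) 1?eq_sym //= addrA lerDl.
  by apply: sumr_ge0 => l _; rewrite sqr_ge0.
have P_ge0 := sqr_ge0 (\sum_l a l).
move: dev q_le P_ge0; set Q := \sum_l _ ^+ 2; set P := (\sum_l a l) ^+ 2 => dev q_le P_ge0.
have sq1 := sqr_ge0 (a i - a j); have sq2 := sqr_ge0 (a i + a j).
case: k k_gt0 => // -[|k] _.
  have rsq : 0 <= (r%:R + 1) * (a i - a j) ^+ 2 by apply: mulr_ge0 => //; lra.
  by rewrite !expr1; lra.
(* Since [r >= 3], [N >= (r - 1) ^+ 2 >= 2 * (r - 1)]. So even when [P <= r * Q] enters with a minus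
   sign, at least half of [N * Q] survives. *)
set N := (r%:R - 1) ^+ k.+2.
have N_ge : (r%:R - 1) ^+ 2 <= N.
  by rewrite /N -(addn2 k) exprD ler_peMl ?sqr_ge0 // exprn_ege1 //; lra.
have NQ : (r%:R - 1) ^+ 2 * Q <= N * Q by apply: ler_wpM2r N_ge; nra.
have Nq : (r%:R - 1) ^+ 2 * (a i ^+ 2 + a j ^+ 2) <= N * (a i ^+ 2 + a j ^+ 2).
  by apply: ler_wpM2r N_ge; nra.
have N_ge0 : 0 <= N by nra.
have Nq2 : N * (a i ^+ 2 + a j ^+ 2) <= N * Q by apply: ler_wpM2l.
have rq : 2 * (r%:R - 1) * (a i ^+ 2 + a j ^+ 2)
   <= (r%:R - 1) ^+ 2 * (a i ^+ 2 + a j ^+ 2) by rewrite ler_wpM2r; nra.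
have rQ : 2 * (r%:R - 1) * Q <= (r%:R - 1) ^+ 2 * Q by rewrite ler_wpM2r; nra.
have rij : `|2 * (r%:R - 1) * (a i * a j)| <= (r%:R - 1) * (a i ^+ 2 + a j ^+ 2).
  by rewrite ler_norml; apply/andP; split; nra.
have Q0 : 0 <= Q by nra.
have dev0 : P <= r%:R * Q by nra.
have rQ3 : 3 * Q <= r%:R * Q by apply: ler_wpM2r.
move: rij; rewrite ler_norml => /andP[rij1 rij2].
have -> : (-1) ^+ k.+2 = (-1) ^+ odd k :> R by rewrite signr_odd 2!exprS; ring.
case: (odd k); rewrite ?expr1 ?expr0; lra.
Qed.

(** As [(r - 1) ^+ k >= r - 1], the form is at least [r - 1] times the square of [a i + a j] or of
    [a i - a j]. *)
Lemma pair_form_ge0 a (i j : 'I_r) (k : nat) : (0 < k)%N ->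
  0 <= (r%:R - 1) ^+ k * (a i ^+ 2 + a j ^+ 2)
    + 2 * (r%:R - 1) * ((-1) ^+ k * (a i * a j)).
Proof.
move=> k_gt0.
have r3 : 3 <= r%:R :> R by rewrite ler_nat.
have sq1 := sqr_ge0 (a i - a j); have sq2 := sqr_ge0 (a i + a j).
have : (r%:R - 1) * (a i ^+ 2 + a j ^+ 2) <= (r%:R - 1) ^+ k * (a i ^+ 2 + a j ^+ 2).
  apply: ler_wpM2r; first by nra.
  by case: k k_gt0 => // k _; rewrite exprS ler_peMr ?exprn_ege1 //; lra.
by rewrite -(signr_odd _ k); case: (odd k); rewrite ?expr1 ?expr0; nra.
Qed.

End QuadraticForm.

(** * The numerical dichotomy for the means *)

Section Dichotomy.
Variables (R : realFieldType) (r : nat).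
Hypothesis r_ge3 : (3 <= r)%N.

(** Summing the pair relations over [j] makes all [f i = a i * (1 - a i)] nearly equal, hence [f i]
    is close to [(r - 1) * a i * a j]. Dividing by some [a M >= 1/r] determines every other [a j]
    from [a M], and [f M = f j] becomes a quadratic in [a M] with roots [1] and [1/r]. *)
Lemma mean_dichotomy (a : 'I_r -> R) (eta : R) :
  (forall i, 0 <= a i <= 1) -> 0 <= eta ->
  1 <= \sum_i a i <= 1 + eta ->
  (forall i j, i != j ->
     `|a i * (1 - a i) + a j * (1 - a j) - 2 * (r%:R - 1) * (a i * a j)|
       <= 4 * r%:R * eta) ->
  (exists k, 1 - 18 * r%:R ^+ 4 * eta <= a k) \/
  (forall i, `|a i - r%:R^-1| <= 18 * r%:R ^+ 4 * eta).
Proof.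
move=> a01 eta_ge0 /andP[s_ge1 s_le] pair.
have r3 : 3 <= r%:R :> R by rewrite ler_nat.
set q : R := r%:R in r3 s_ge1 s_le pair *.
pose f i := a i * (1 - a i).
set s := \sum_i a i in s_ge1 s_le; pose P := \sum_i f i.
have near_avg i : `|q * f i - P| <= 4 * q ^+ 2 * eta.
  have E : \sum_(j < r | j != i) (f i + f j - 2 * (q - 1) * (a i * a j)) =
      P - q * f i - 2 * (q - 1) * a i * (s - 1).
    have Pi : P = f i + \sum_(j < r | j != i) f j by rewrite /P (bigD1 i).
    have si : s = a i + \sum_(j < r | j != i) a j by rewrite /s (bigD1 i).
    have -> : \sum_(j < r | j != i) (f i + f j - 2 * (q - 1) * (a i * a j)) =
        (q - 1) * f i + (P - f i) - 2 * (q - 1) * a i * (s - a i).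
      rewrite Pi si sumrB big_split /= sumr_const (eq_card (B := predC1 i)) //.
      rewrite cardC1 card_ord -(mulr_natl (f i)) -subn1 natrB -/q; last first.
        exact: leq_trans r_ge3.
      rewrite ![_ + _ - _]addrC !addKr; congr (- _ + _).
      by rewrite mulr_sumr; apply: eq_bigr => j _; rewrite mulrA.
    by rewrite /f; ring.
  have le : `|P - q * f i - 2 * (q - 1) * a i * (s - 1)| <= (q - 1) * (4 * q * eta).
    rewrite -E; apply: le_trans (ler_norm_sum _ _ _) _.
    apply: (@le_trans _ _ (\sum_(j < r | j != i) 4 * q * eta)).
      by apply: ler_sum => j ji; apply: pair; rewrite eq_sym.
    rewrite sumr_const (eq_card (B := predC1 i)) // cardC1 card_ord.
    by rewrite -(mulr_natl (4 * q * eta)) -subn1 natrB ?(leq_trans _ r_ge3).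
  have /andP[a0 a1] := a01 i.
  have d1 : a i * (s - 1) <= eta by nra.
  have d0 : 0 <= a i * (s - 1) by nra.
  have d2 : (q - 1) * (a i * (s - 1)) <= (q - 1) * eta by rewrite ler_wpM2l //; lra.
  have d3 : 0 <= (q - 1) * (a i * (s - 1)) by rewrite mulr_ge0 //; lra.
  by move: le; rewrite !ler_norml => /andP[l1 l2]; apply/andP; split; nra.
have close i j : `|f i - f j| <= 8 * q * eta.
  rewrite -(ler_pM2l (_ : 0 < q)); last lra.
  rewrite -{1}(ger0_norm (_ : 0 <= q)); last lra.
  rewrite -normrM mulrBr; have := near_avg i; have := near_avg j.
  by rewrite !ler_norml => /andP[? ?] /andP[? ?]; apply/andP; split; nra.
have prod i j : i != j -> `|f i - (q - 1) * (a i * a j)| <= 6 * q * eta.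
  move=> ij; have := pair i j ij; have := close i j; rewrite -/(f i) -/(f j).
  by rewrite !ler_norml => /andP[? ?] /andP[? ?]; apply/andP; split; nra.
have [M aM] : exists M, q^-1 <= a M.
  apply/existsP; apply: contraT; rewrite negb_exists => /forallP lt.
  suff : s < 1 by lra.
  have -> : 1 = \sum_(i < r) q^-1.
    by rewrite sumr_const card_ord -(mulr_natl (q^-1)) mulfV // gt_eqF //; lra.
  apply: ltr_sum => [|i _]; last by rewrite ltNge lt.
  by apply/hasP; exists (Ordinal (leq_trans (ltn0Sn 2) r_ge3)); rewrite ?mem_index_enum.
have /andP[aM0 aM1] := a01 M.
have qaM : 1 <= q * a M by rewrite -(@mulfV _ q) ?ler_pM2l ?gt_eqF //; lra.
have far j : j != M -> `|1 - a M - (q - 1) * a j| <= 6 * q ^+ 2 * eta.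
  move=> jM; have := prod M j; rewrite eq_sym jM => /(_ isT).
  rewrite (_ : _ - _ = a M * (1 - a M - (q - 1) * a j)); last by rewrite /f; ring.
  rewrite normrM (ger0_norm aM0) => le1.
  have := ler_wpM2l (_ : 0 <= q) le1; rewrite mulrA => /(_ _).
  have := normr_ge0 (1 - a M - (q - 1) * a j); set y := `|_|; nra.
pose u := 1 - a M.
have u_ge0 : 0 <= u by rewrite /u; lra.
have [j jM] : exists j : 'I_r, j != M.
  have : (0 < #|predC1 M|)%N by rewrite cardC1 card_ord -subn1 subn_gt0 (leq_trans _ r_ge3).
  by case/card_gt0P => j; exists j.
(* [D] is the error in [far]; at [D = 0] the difference [f M - f j] is exactly a multiple of
   [u * (q * a M - 1)], and [g] is the cofactor of the remainder. *)
have key : u * (q * a M - 1) <= 9 * q ^+ 4 * eta.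
  have /andP[j0 j1] := a01 j.
  pose D := u - (q - 1) * a j; pose g := (q - 1) * (1 - a j) - u.
  have gD : `|g * D| <= q * (6 * q ^+ 2 * eta).
    rewrite normrM ler_pM ?normr_ge0 ?far // ler_norml /g /u.
    by apply/andP; split; nra.
  have := close M j; rewrite ler_norml => /andP[_ c].
  have c' : (q - 1) ^+ 2 * (f M - f j) <= q ^+ 2 * (8 * q * eta).
    apply: (@le_trans _ _ ((q - 1) ^+ 2 * (8 * q * eta))).
      by rewrite ler_wpM2l ?sqr_ge0.
    rewrite ler_wpM2r //; last by nra.
    by rewrite !mulr_ge0 //; lra.
  have E : (q - 1) ^+ 2 * (f M - f j) = (q - 2) * (u * (q * a M - 1)) + g * D.
    by rewrite /f /g /D /u; ring.
  have v0 : 0 <= u * (q * a M - 1) by rewrite mulr_ge0 //; lra.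
  have v1 : u * (q * a M - 1) <= (q - 2) * (u * (q * a M - 1)).
    by rewrite ler_peMl //; lra.
  have q3 : 3 * (q ^+ 3 * eta) <= q * (q ^+ 3 * eta).
    by rewrite ler_wpM2r // mulr_ge0 // exprn_ge0 //; lra.
  have q3' : 0 <= q ^+ 3 * eta by rewrite mulr_ge0 // exprn_ge0 //; lra.
  by move: gD; rewrite ler_norml => /andP[g1 _]; lra.
(* One of the two factors in [key] is at least [1/2], which doubles the constant 9 to 18. *)
have [u_half|u_half] := lerP u 2^-1.
  left; exists M.
  have half : 2^-1 <= q * a M - 1 by rewrite /u in u_half; nra.
  have := ler_wpM2l u_ge0 half; rewrite /u in key *; lra.
right => i.
have w_le : q * a M - 1 <= 18 * q ^+ 4 * eta by nra.
have q4 : q ^+ 4 * eta = q * q * (q ^+ 2 * eta) by ring.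
have qeta : 0 <= q ^+ 2 * eta by rewrite mulr_ge0 ?sqr_ge0.
pose w := a M - q^-1.
have qw : q * w = q * a M - 1 by rewrite /w mulrBr mulfV // gt_eqF //; lra.
have w0 : 0 <= w by rewrite /w subr_ge0.
have w_le' : w <= 18 * q ^+ 4 * eta by nra.
have [->|iM] := eqVneq i M; first by rewrite ger0_norm.
have := far i iM; rewrite !ler_norml.
have -> : 1 - a M - (q - 1) * a i = - w - (q - 1) * (a i - q^-1).
  by rewrite /w; field; rewrite gt_eqF //; lra.
set z := a i - q^-1 => /andP[z1 z2].
have q2 : 9 * (q ^+ 2 * eta) <= q * q * (q ^+ 2 * eta) by rewrite ler_wpM2r //; nra.
by apply/andP; split; nra.
Qed.

End Dichotomy.

(** * Covers by color-class events and the variance bound *)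

Section Covers.
Variables (R : realFieldType) (T : finType) (r : nat).
Hypothesis r_ge3 : (3 <= r)%N.
Implicit Types (h : 'I_r -> {set T} -> bool) (eta : R).

Let r_gt0 : (0 < r)%N. Proof. exact: leq_trans r_ge3. Qed.

Definition covers h := forall c, exists i, h i (color_class c i).

Definition prob (E : {ffun T -> 'I_r} -> bool) : R := expect (fun c => (E c)%:R).

Definition hit h i : R := prob (fun c => h i (color_class c i)).

Lemma eq_prob E E' : E =1 E' -> prob E = prob E'.
Proof. by move=> EE'; apply: eq_expect => c; rewrite EE'. Qed.

Lemma prob_ge0 E : 0 <= prob E.
Proof.
by rewrite -[leLHS](expect_const T r_gt0); apply: ler_expect => c; rewrite ler0n.
Qed.

Lemma prob_le1 E : prob E <= 1.
Proof.
by rewrite -[leRHS](expect_const T r_gt0); apply: ler_expect => c; rewrite lern1 leq_b1.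
Qed.

Lemma probC E : prob (fun c => ~~ E c) = 1 - prob E.
Proof.
apply/eqP; rewrite eq_sym subr_eq -expectD; apply/eqP/esym.
rewrite -[RHS](expect_const T r_gt0).
by apply: eq_expect => c; case: (E c); rewrite ?addr0 ?add0r.
Qed.

Lemma sum_hit_ge1 h : covers h -> 1 <= \sum_i hit h i.
Proof.
move=> cov; rewrite -expect_sum -[leLHS](expect_const T r_gt0).
apply: ler_expect => c; have [i hi] := cov c.
by rewrite (bigD1 i) //= hi lerDl sumr_ge0.
Qed.

(** [A] is a sum of nonnegative pair forms over nonempty frequencies, bounded by four times the
    variance of the number [Z] of events that occur. Discarding the joint probability [m i j] costs
    only [O(eta)]. *)
Lemma hit_pair h eta i j : covers h -> \sum_i hit h i <= 1 + eta -> i != j ->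
  `|hit h i * (1 - hit h i) + hit h j * (1 - hit h j)
     - 2 * (r%:R - 1) * (hit h i * hit h j)| <= 4 * r%:R * eta.
Proof.
move=> cov s_le ij; have s_ge1 := sum_hit_ge1 cov.
have r3 : 3 <= r%:R :> R by rewrite ler_nat.
set s := \sum_i hit h i in s_le s_ge1.
pose H i c : R := (h i (color_class c i))%:R.
pose m i j := expect (fun c => H i c * H j c).
have [al hal] : exists al : 'I_r -> {set T} -> R, forall i c,
    H i c = \sum_(S : {set T}) al i S * chi R r S (color_class c i).
  have /fin_all_exists[al hal] i' :=
    chi_span (R := R) r_gt0 (fun D => (h i' D)%:R).
  by exists al => i' c; apply: hal.
have hitE i' : hit h i' = al i' set0.
  rewrite /hit /prob -(expect_chi_mean r_gt0 i').
  by apply: eq_expect => c; rewrite -hal.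
have mE i' j' : m i' j' = \sum_(S : {set T}) al i' S * al j' S *
    (if i' == j' then r%:R - 1 else -1) ^+ #|S|.
  rewrite -(expect_chi_expansion r_gt0).
  by apply: eq_expect => c; rewrite -!hal.
have mii i' : m i' i' = hit h i'.
  by apply: eq_expect => c; rewrite /H; case: (h _ _); rewrite ?mulr0 ?mulr1.
have mE0 i' j' : m i' j' - hit h i' * hit h j' =
    \sum_(S : {set T} | S != set0) al i' S * al j' S *
    (if i' == j' then r%:R - 1 else -1) ^+ #|S|.
  by rewrite mE (bigD1 set0) //= cards0 mulr1 !hitE addrC addrK.
have S_gt0 (S : {set T}) : S != set0 -> (0 < #|S|)%N by rewrite card_gt0.
set A := hit h i * (1 - hit h i) + hit h j * (1 - hit h j)
         + 2 * (r%:R - 1) * (m i j - hit h i * hit h j).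
have AE : A = \sum_(S : {set T} | S != set0)
    ((r%:R - 1) ^+ #|S| * (al i S ^+ 2 + al j S ^+ 2)
     + 2 * (r%:R - 1) * ((-1) ^+ #|S| * (al i S * al j S))).
  have Ai k : hit h k * (1 - hit h k) = m k k - hit h k * hit h k.
    by rewrite mii; ring.
  rewrite /A !Ai !mE0 !eqxx (negPf ij) mulr_sumr -!big_split /=.
  by apply: eq_bigr => S _; ring.
have A_ge0 : 0 <= A.
  rewrite AE; apply: sumr_ge0 => S /S_gt0 S0.
  exact: (pair_form_ge0 r_ge3 (al^~ S) i j S0).
(* From [1 <= Z <= r] comes [Z ^+ 2 <= (r + 1) * Z - r], so the variance is at most
   [(s - 1) * (r - s)]. *)
have A_le : A <= 4 * ((r%:R + 1) * s - r%:R - s ^+ 2).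
  apply: (@le_trans _ _ (4 * \sum_k \sum_l (m k l - hit h k * hit h l))).
    rewrite AE mulr_sumr.
    rewrite (eq_bigr (fun k => \sum_(S : {set T} | S != set0) 4 * \sum_l
      al k S * al l S * (if k == l then r%:R - 1 else -1) ^+ #|S|)); last first.
      move=> k _; rewrite -mulr_sumr exchange_big /=; congr (_ * _).
      by apply: eq_bigr => l _; rewrite mE0.
    rewrite exchange_big /=; apply: ler_sum => S /S_gt0 S0.
    by rewrite -mulr_sumr; exact: (pair_form_le r_ge3 (al^~ S) ij S0).
  rewrite ler_pM2l //.
  have -> : \sum_k \sum_l (m k l - hit h k * hit h l) =
      \sum_k \sum_l m k l - s ^+ 2.
    rewrite expr2 big_distrlr -sumrB; apply: eq_bigr => k _.
    by rewrite sumrB.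
  rewrite lerD2r.
  have -> : \sum_k \sum_l m k l = expect (fun c => (\sum_k H k c) ^+ 2).
    under [RHS]eq_expect do rewrite expr2 big_distrlr /=.
    by rewrite expect_sum; apply: eq_bigr => k _; rewrite expect_sum.
  have -> : (r%:R + 1) * s - r%:R =
      expect (fun c => (r%:R + 1) * (\sum_k H k c) + (- r%:R)).
    by rewrite expectD expectZ expect_sum expect_const.
  apply: ler_expect => c.
  have Z1 : 1 <= \sum_k H k c.
    by have [k hk] := cov c; rewrite (bigD1 k) //= /H hk lerDl sumr_ge0.
  have Zr : \sum_k H k c <= r%:R.
    rewrite -[X in X%:R](card_ord r) -sum1_card natr_sum; apply: ler_sum => k _.
    by rewrite /H lern1 leq_b1.
  nra.
have m_ge0 : 0 <= m i j.
  rewrite -[leLHS](expect_const T r_gt0); apply: ler_expect => c.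
  by rewrite mulr_ge0 ?ler0n.
(* Two simultaneous events force [Z >= 2], and [Z >= 1] always, so [H i * H j <= Z - 1]
   pointwise. *)
have m_le : m i j <= s - 1.
  have -> : s - 1 = expect (fun c => \sum_k H k c + (-1)).
    by rewrite expectD expect_sum expect_const.
  apply: ler_expect => c; rewrite lerBrDr.
  have [k hk] := cov c; rewrite /H.
  have rest (P : pred 'I_r) : 0 <= \sum_(k | P k) H k c :> R by rewrite sumr_ge0.
  case hi : (h i _); last first.
    rewrite mul0r add0r (bigD1 k) //= hk lerDl; exact: rest.
  case hj : (h j _); last first.
    rewrite mulr0 add0r (bigD1 k) //= hk lerDl; exact: rest.
  rewrite (bigD1 i) //= (bigD1 j) 1?eq_sym //= hi hj mulr1 addrA lerDl.
  exact: rest.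
rewrite ler_norml; apply/andP; split; rewrite /A in A_ge0 A_le; nra.
Qed.

Lemma hit_dichotomy h eta : covers h -> \sum_i hit h i <= 1 + eta ->
  (exists k, 1 - 18 * r%:R ^+ 4 * eta <= hit h k) \/
  (forall i, `|hit h i - r%:R^-1| <= 18 * r%:R ^+ 4 * eta).
Proof.
move=> cov s_le; have s_ge1 := sum_hit_ge1 cov.
apply: mean_dichotomy => //.
- by move=> i; rewrite prob_ge0 prob_le1.
- by move: (le_trans s_ge1 s_le); rewrite lerDl.
- by rewrite s_ge1.
- by move=> i j; apply: hit_pair.
Qed.

End Covers.

(** * Fixing the color of one point, and the induction *)

Section Restriction.
Variables (R : realFieldType) (T : finType) (r : nat).
Hypothesis r_ge3 : (3 <= r)%N.
Implicit Types (h : 'I_r -> {set T} -> bool) (g : {set T} -> bool).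

Let r_gt0 : (0 < r)%N. Proof. exact: leq_trans r_ge3. Qed.
Let r_ge3R : 3 <= r%:R :> R. Proof. by rewrite ler_nat. Qed.

(** The restriction stays on the ground set [T]; [x] merely becomes irrelevant, so all probabilities
    live in one space. *)
Definition fix_color h x k (i : 'I_r) (D : {set T}) : bool :=
  h i (if i == k then x |: D else D :\ x).

Definition present g (i : 'I_r) x : R := prob R (fun c => g (x |: color_class c i)).
Definition absent g (i : 'I_r) x : R := prob R (fun c => g (color_class c i :\ x)).

Lemma hit_fix_color h x k i :
  hit R (fix_color h x k) i = if i == k then present (h i) i x else absent (h i) i x.
Proof. by rewrite /hit /fix_color; case: (i == k). Qed.

Lemma covers_fix_color h x k : covers h -> covers (fix_color h x k).
Proof.
move=> cov c; have [i hi] := cov (recolor c x k); exists i.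
by move: hi; rewrite color_class_recolor.
Qed.

Lemma sum_hit_fix_color h x :
  \sum_k \sum_i hit R (fix_color h x k) i = r%:R * \sum_i hit R h i.
Proof.
have r0 : r%:R != 0 :> R by rewrite pnatr_eq0 -lt0n.
rewrite exchange_big mulr_sumr; apply: eq_bigr => i _.
rewrite /hit [in RHS]/prob (expect_recolor r_gt0 x) mulVKf //.
by apply: eq_bigr => k _; apply: eq_expect => c; rewrite color_class_recolor.
Qed.

Lemma prob_split g i x :
  r%:R * prob R (fun c => g (color_class c i)) =
  present g i x + (r%:R - 1) * absent g i x.
Proof.
have r0 : r%:R != 0 :> R by rewrite pnatr_eq0 -lt0n.
rewrite {1}/prob (expect_recolor r_gt0 x) mulVKf // (bigD1 i) //=.
congr (_ + _).
  by apply: eq_expect => c; rewrite color_class_recolor // eqxx.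
rewrite (eq_bigr (fun=> absent g i x)) => [|k ki].
  rewrite sumr_const (eq_card (B := predC1 i)) // cardC1 card_ord.
  by rewrite -(mulr_natl (absent g i x)) -subn1 natrB.
by apply: eq_expect => c; rewrite color_class_recolor // eq_sym (negPf ki).
Qed.

(** The other [r - 1] restrictions are covers with sums at least 1, so in the worst case color [k]
    carries the whole excess [r * eta]. *)
Lemma sum_hit_fix_color_le h x k (eta : R) : covers h ->
  \sum_i hit R h i <= 1 + eta ->
  \sum_i hit R (fix_color h x k) i <= 1 + r%:R * eta.
Proof.
move=> cov s_le; have := sum_hit_fix_color h x; rewrite (bigD1 k) //=.
have : r%:R - 1 <= \sum_(l < r | l != k) \sum_i hit R (fix_color h x l) i.
  apply: (@le_trans _ _ (\sum_(l < r | l != k) 1)).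
    rewrite sumr_const (eq_card (B := predC1 k)) // cardC1 card_ord.
    by rewrite -subn1 natrB.
  apply: ler_sum => l _; apply: sum_hit_ge1 => //.
  exact: covers_fix_color.
have : r%:R * (\sum_i hit R h i) <= r%:R * (1 + eta) by rewrite ler_wpM2l.
lra.
Qed.

Lemma exists_fix_color_le h x (eta : R) :
  \sum_i hit R h i <= 1 + eta ->
  exists k, \sum_i hit R (fix_color h x k) i <= 1 + eta.
Proof.
move=> s_le; apply/existsP; apply: contraT; rewrite negb_exists => /forallP lt.
suff : r%:R * (1 + eta) < r%:R * \sum_i hit R h i.
  by rewrite ltr_pM2l ?ltr0n // ltNge s_le.
rewrite -(sum_hit_fix_color h x) mulr_natl -[X in _ *+ X](card_ord r) -sumr_const.
apply: ltr_sum => [|k _]; last by rewrite ltNge lt.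
by apply/hasP; exists (Ordinal r_gt0); rewrite ?mem_index_enum.
Qed.

Let K : R := 18 * r%:R ^+ 4.

Let prob01 (E : {ffun T -> 'I_r} -> bool) : 0 <= prob R E <= 1.
Proof. by rewrite prob_ge0 ?prob_le1. Qed.

Let exists_other (k l : 'I_r) : exists j : 'I_r, (j != k) && (j != l).
Proof.
have : (0 < #|~: [set k; l]|)%N.
  rewrite cardsCs setCK card_ord subn_gt0; apply: leq_ltn_trans r_ge3.
  by rewrite cards2; case: (k != l).
by case/card_gt0P => j; rewrite !inE negb_or; exists j.
Qed.

(* Restricting c x to k or to k' changes h i in the same way as soon as i differs
   from both k and k'; since r >= 3 this rules out, for every k, all outcomes of
   the dichotomy for the restriction c x = k other than hitting k. *)
Lemma star_of_restriction h x (eta : R) (k M : 'I_r) :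
  covers h -> \sum_i hit R h i <= 1 + eta ->
  6 * ((2 * K + 1) * r%:R ^+ 2 * eta) <= 1 ->
  (forall i, `|hit R h i - r%:R^-1| <= K * eta) ->
  1 - K * (r%:R * eta) <= hit R (fix_color h x k) M ->
  forall i, prob R (fun c => h i (color_class c i) != (x \in color_class c i))
    <= (2 * K + 1) * r%:R * eta.
Proof.
move=> cov s_le small near hM.
have eta_ge0 : 0 <= eta.
  by move: (le_trans (sum_hit_ge1 R r_ge3 cov) s_le); rewrite lerDl.
have q3 := r_ge3R; set q : R := r%:R in q3 small near hM *.
have K_ge0 : 0 <= K by rewrite /K mulr_ge0 ?exprn_ge0.
(* [v] bounds the excess of any restriction at one point, and [e] is the resulting error in the
   dichotomy. *)
pose v := q * eta; pose e := K * v.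
have v_ge0 : 0 <= v by rewrite /v mulr_ge0 //; lra.
have e_ge0 : 0 <= e by rewrite mulr_ge0.
have qv_ge0 : 0 <= q * v by rewrite mulr_ge0 //; lra.
have {}small : 6 * (2 * (q * e) + q * v) <= 1.
  rewrite (_ : 2 * (q * e) + q * v = (2 * K + 1) * q ^+ 2 * eta) //.
  by rewrite /e /v; ring.
have qe : 3 * e <= q * e by rewrite ler_wpM2r.
pose t i := present (h i) i x; pose b i := absent (h i) i x.
have t01 i : 0 <= t i <= 1 by exact: prob01.
have b01 i : 0 <= b i <= 1 by exact: prob01.
(* Otherwise [q * hit R h i >= (q - 1) * (1 - e)], which is about 2 or more, whereas [near] makes it
   about 1. *)
have b_lt i : b i < 1 - e.
  rewrite ltNge; apply/negP => bi; have := near i; rewrite ler_norml => /andP[_ ai].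
  have := prob_split (h i) i x; rewrite -/(hit R h i) -/(t i) -/(b i) -/q => E.
  have : q * (hit R h i - q^-1) <= q * (K * eta) by rewrite ler_wpM2l //; lra.
  have : (q - 1) * (1 - e) <= (q - 1) * b i by rewrite ler_wpM2l //; lra.
  have := t01 i; rewrite (mulrBr _ _ q^-1) mulfV ?gt_eqF //; last by lra.
  rewrite (_ : q * (K * eta) = e); last by rewrite /e /v; ring.
  lra.
have color k' M' : 1 - e <= hit R (fix_color h x k') M' -> 1 - e <= t k'.
  rewrite hit_fix_color; case: eqVneq => [-> //|_].
  by rewrite -/(b M') leNgt b_lt.
(* [t k'] already uses up almost all of the total [1 + v]. *)
have b_le k' i : 1 - e <= t k' -> i != k' -> b i <= v + e.
  move=> tk ik; have := sum_hit_fix_color_le x k' cov s_le.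
  rewrite (bigD1 k') //= (bigD1 i) //= !hit_fix_color eqxx (negPf ik).
  rewrite -/(t k') -/(b i) -/q -/v.
  have : 0 <= \sum_(l < r | (l != k') && (l != i)) hit R (fix_color h x k') l.
    by apply: sumr_ge0 => l _; apply: prob_ge0.
  lra.
have tk : 1 - e <= t k by apply: color hM.
have t_all k' : 1 - e <= t k'.
  have := hit_dichotomy r_ge3 (covers_fix_color x k' cov)
    (sum_hit_fix_color_le x k' cov s_le).
  rewrite -/q -/v -/K -/e => -[[M' hM']|near']; first exact: color hM'.
  have [j /andP[jk jk']] := exists_other k k'.
  have := near' j; rewrite hit_fix_color (negPf jk') -/(b j) ler_norml => /andP[nj _].
  have bj := b_le k j tk jk.
  have : q * (q^-1 - e) <= q * (v + e) by rewrite ler_wpM2l //; lra.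
  rewrite (mulrBr _ q^-1) mulfV ?gt_eqF //; last by lra.
  lra.
move=> i; have [k' /andP[k'i _]] := exists_other i i.
have bi := b_le k' i (t_all k'); rewrite eq_sym k'i in bi; have {}bi := bi isT.
(* Disagreement with the star of [x] has probability [1 - t i] when [x] is present and [b i] when it
   is absent. *)
have := prob_split (fun D => h i D != (x \in D)) i x.
have -> : present (fun D => h i D != (x \in D)) i x = 1 - t i.
  rewrite -probC //; apply: eq_prob => c.
  by rewrite !inE eqxx /=; case: (h i _).
have -> : absent (fun D => h i D != (x \in D)) i x = b i.
  by apply: eq_prob => c; rewrite !inE eqxx /=; case: (h i _).
rewrite -/q => E.
have := t_all i; rewrite -(ler_pM2l (_ : 0 < q)); last by lra.
move=> ti; rewrite -(ler_pM2l (_ : 0 < q)); last by lra.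
rewrite E (_ : q * _ = 2 * (q * e) + q * v); last by rewrite /e /v; ring.
have : (q - 1) * b i <= (q - 1) * (v + e) by rewrite ler_wpM2l //; lra.
have := t_all i; lra.
Qed.

(* Induction on #|Y|: the restricted coordinate is given a color that does not
   increase the excess eta. The constants do not deteriorate along the induction,
   because each step is concluded by star_of_restriction at the current h. *)
Lemma const_or_star (h : 'I_r -> {set T} -> bool) (Y : {set T}) (eta : R) :
  covers h -> \sum_i hit R h i <= 1 + eta ->
  6 * ((2 * K + 1) * r%:R ^+ 2 * eta) <= 1 ->
  (forall i D, h i (D :&: Y) = h i D) ->
  (exists k, 1 - K * eta <= hit R h k) \/
  (exists2 x, x \in Y & forall i,
     prob R (fun c => h i (color_class c i) != (x \in color_class c i))
     <= (2 * K + 1) * r%:R * eta).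
Proof.
move=> cov s_le small; have [n] := ubnP #|Y|.
elim: n h Y cov s_le => // n IHn h Y cov s_le Yn hY.
have eta_ge0 : 0 <= eta.
  by move: (le_trans (sum_hit_ge1 R r_ge3 cov) s_le); rewrite lerDl.
have [//|near] := hit_dichotomy r_ge3 cov s_le; first by left.
have q3 := r_ge3R; set q : R := r%:R in q3 small near *; rewrite -/K in near.
have K_ge0 : 0 <= K by rewrite /K mulr_ge0 ?exprn_ge0.
pose v := q * eta; pose e := K * v.
have v_ge0 : 0 <= v by rewrite /v mulr_ge0 //; lra.
have e_ge0 : 0 <= e by rewrite mulr_ge0.
have qv_ge0 : 0 <= q * v by rewrite mulr_ge0 //; lra.
have small' : 6 * (2 * (q * e) + q * v) <= 1.
  rewrite (_ : 2 * (q * e) + q * v = (2 * K + 1) * q ^+ 2 * eta) //.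
  by rewrite /e /v; ring.
have qe : 3 * e <= q * e by rewrite ler_wpM2r.
have qV : q * q^-1 = 1 by rewrite mulfV // gt_eqF //; lra.
(* Without relevant points each [hit] is 0 or 1, which is far from [1/r]. *)
have [Y0|[y yY]] := set_0Vmem Y.
  have := near (Ordinal r_gt0); set i := Ordinal _.
  have -> : hit R h i = (h i set0)%:R.
    rewrite -[RHS](expect_const T r_gt0); apply: eq_expect => c.
    by rewrite -hY Y0 setI0.
  rewrite ler_norml => /andP[n1 n2]; exfalso.
  have m1 : q * - (K * eta) <= q * ((h i set0)%:R - q^-1) by rewrite ler_wpM2l //; lra.
  have m2 : q * ((h i set0)%:R - q^-1) <= q * (K * eta) by rewrite ler_wpM2l //; lra.
  have eE : q * (K * eta) = e by rewrite /e /v; ring.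
  by move: m1 m2; case: (h i set0) => /=; lra.
right; have [k sk] := exists_fix_color_le y s_le.
have cov_k := covers_fix_color y k cov.
have star x (l M : 'I_r) : x \in Y -> 1 - e <= hit R (fix_color h x l) M ->
    exists2 x, x \in Y & forall i,
     prob R (fun c => h i (color_class c i) != (x \in color_class c i))
     <= (2 * K + 1) * q * eta.
  by move=> xY hM; exists x => //; apply: star_of_restriction hM.
case: (IHn _ (Y :\ y) cov_k sk).
- by move: Yn; rewrite (cardsD1 y) yY.
- move=> i D; rewrite /fix_color -hY -[RHS]hY; congr (h i _).
  apply/setP => z; case: (i == k); rewrite !inE; case: (eqVneq z y) => //= _;
    by rewrite -andbA andbb.
- case=> M hM; apply: (star y k M yY); apply: le_trans hM; rewrite lerD2l lerN2.
  by rewrite /e ler_wpM2l // /v; nra.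
case=> x; rewrite !inE => /andP[xy xY] hx.
(* For [i != k], fixing [y] to [k] removes [y] from class [i], an event of probability [(r - 1)/r].
   There [h i] nearly always holds once [x] is present, so [present (h i) i x] is far above [1/r]
   and fixing [x] to [i] cannot be balanced. *)
have [i /andP[ik _]] := exists_other k k.
case: (hit_dichotomy r_ge3 (covers_fix_color x i cov)
        (sum_hit_fix_color_le x i cov s_le)) => [[M hM]|near_i].
  exact: (star x i M xY hM).
exfalso; have := near_i i; rewrite hit_fix_color eqxx -/q -/v -/K -/e.
rewrite ler_norml => /andP[_ up].
pose g D := h i (D :\ y).
have hit_g : 1 - present g i x <= 2 * (q * e) + q * v.
  have := hx i.
  have -> : prob R (fun c => fix_color h y k i (color_class c i)
                             != (x \in color_class c i))
      = prob R (fun c => g (color_class c i) != (x \in color_class c i)).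
    by apply: eq_prob => c; rewrite /fix_color (negPf ik).
  rewrite -(ler_pM2l (_ : 0 < q)); last by lra.
  rewrite /q (prob_split (fun D => g D != (x \in D)) i x) -/q.
  have -> : present (fun D => g D != (x \in D)) i x = 1 - present g i x.
    rewrite -probC //; apply: eq_prob => c.
    by rewrite !inE eqxx /=; case: (g _).
  have : 0 <= (q - 1) * absent (fun D => g D != (x \in D)) i x.
    by rewrite mulr_ge0 ?prob_ge0 //; lra.
  rewrite (_ : q * ((2 * K + 1) * q * eta) = 2 * (q * e) + q * v); first by lra.
  by rewrite /e /v; ring.
have := prob_split (fun D => h i (x |: D)) i y.
rewrite -/(present (h i) i x) -/q.
have -> : absent (fun D => h i (x |: D)) i y = present g i x.
  apply: eq_prob => c; rewrite /g; congr (h i _); apply/setP => z.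
  by rewrite !inE; case: (eqVneq z x) => [->|//]; rewrite xy.
have : 0 <= present (fun D => h i (x |: D)) i y by rewrite prob_ge0.
have : (q - 1) * (1 - 6^-1) <= (q - 1) * present g i x by rewrite ler_wpM2l //; lra.
have : q * (present (h i) i x - q^-1) <= q * e by rewrite ler_wpM2l //; lra.
lra.
Qed.

End Restriction.

(** * Transfer to biased measures and conclusion *)

(** Each point avoids color [i] independently with probability [(r - 1)/r]. Since [i] is arbitrary,
    each family can be read off its own class of one common coloring. *)
Lemma biased_measure_prob (R : realType) (r n : nat) (A : {set {set 'I_n}})
    (i : 'I_r) :
  biased_measure (pstar R r) A = prob R (fun c => ~: color_class c i \in A).
Proof.
have r_gt0 : (0 < r)%N by apply: leq_ltn_trans (ltn_ord i).
have r0 : r%:R != 0 :> R by rewrite pnatr_eq0 -lt0n.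
have indE c : (~: color_class c i \in A)%:R =
    \sum_(B in A) \prod_x (((x \in B) == (c x != i))%:R : R).
  have E (B : {set 'I_n}) : \prod_x (((x \in B) == (c x != i))%:R : R) =
      (B == ~: color_class c i)%:R.
    case: eqVneq => [->|neq].
      by rewrite big1 // => x _; rewrite !inE eqxx.
    apply/eqP; apply: contraNT neq => /prodf_neq0 nz; apply/eqP/setP => x.
    by have := nz x isT; rewrite !inE; case: (x \in B); case: (c x == i); rewrite ?eqxx.
  rewrite (eq_bigr _ (fun B _ => E B)); case: (boolP (_ \in A)) => inA.
    rewrite (bigD1 (~: color_class c i)) //= eqxx big1 ?addr0 // => B.
    by case/andP => _ /negPf ->.
  rewrite big1 // => B BA; case: eqVneq => // BE; by rewrite -BE BA in inA.
rewrite /prob (eq_expect indE) expect_sum; apply: eq_bigr => B _.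
rewrite (expect_prod (fun x k => ((x \in B) == (k != i))%:R)).
have factor x : r%:R^-1 * \sum_(k < r) ((x \in B) == (k != i))%:R =
    (if x \in B then pstar R r else 1) * (if x \notin B then 1 - pstar R r else 1).
  rewrite (bigD1 i) //= eqxx.
  rewrite (eq_bigr (fun=> (x \in B)%:R)) => [|k ->]; last by case: (x \in B).
  rewrite sumr_const (eq_card (B := predC1 i)) // cardC1 card_ord -subn1.
  by rewrite -[_ *+ (r - 1)]mulr_natr natrB // /pstar; case: (x \in B) => /=; field.
rewrite (eq_bigr _ (fun x _ => factor x)) big_split /= -!big_mkcond /=.
rewrite !prodr_const; congr (_ * _ ^+ _).
by rewrite -[X in (X - _)%N](card_ord n) -(cardC (mem B)) addKn.
Qed.

Theorem theorem1p4 (R : realType) (r : nat) (hr : (3 <= r)%N) :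
  exists eta0 C : R, 0 < eta0 /\ 0 < C /\
    forall eta : R, 0 < eta -> eta <= eta0 ->
    forall n : nat, (1 <= n)%N ->
    forall A : 'I_r -> {set {set 'I_n}},
      cross_intersecting A ->
      r%:R - 1 - eta <= \sum_(i < r) biased_measure (pstar R r) (A i) ->
      (exists j : 'I_n, forall i : 'I_r,
          biased_measure (pstar R r) (symdiff (A i) (star j)) <= C * eta)
      \/
      (exists! i : 'I_r,
          biased_measure (pstar R r) (A i) <= C * eta /\
          forall j : 'I_r, j != i ->
            1 - C * eta <= biased_measure (pstar R r) (A j)).
Proof.
have r_gt0 : (0 < r)%N by apply: leq_trans hr.
have r3 : 3 <= r%:R :> R by rewrite ler_nat.
(* [K] is the dichotomy constant and [C] the star constant; the threshold [1/(6 * C * r)] is exactly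
   the smallness condition of [const_or_star]. *)
pose K : R := 18 * r%:R ^+ 4; pose C : R := (2 * K + 1) * r%:R.
have K_ge0 : 0 <= K by rewrite mulr_ge0 ?exprn_ge0.
have C_ge : K + 1 <= C by rewrite /C; nra.
have C_gt0 : 0 < C by lra.
have D_gt0 : 0 < 6 * C * r%:R by rewrite !mulr_gt0 //; lra.
exists (6 * C * r%:R)^-1, C; rewrite invr_gt0; split=> //; split=> //.
move=> eta eta_gt0 eta_le n _ A cross sum_ge.
have small : 6 * (C * eta * r%:R) <= 1.
  by have := ler_wpM2l (ltW D_gt0) eta_le; rewrite mulfV ?gt_eqF //; lra.
have C_half : 2 * (C * eta) < 1 by have := mulr_gt0 C_gt0 eta_gt0; nra.
pose h (i : 'I_r) (D : {set 'I_n}) := ~: D \notin A i.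
have hitE i : biased_measure (pstar R r) (A i) = 1 - hit R h i.
  rewrite -probC // (biased_measure_prob R (A i) i); apply: eq_prob => c.
  by rewrite /h negbK.
have cov : covers h.
  move=> c; apply/existsP; apply: contraT; rewrite negb_exists => /forallP no.
  have /cross : forall i, ~: color_class c i \in A i.
    by move=> i; have := no i; rewrite negbK.
  case/set0Pn => x /bigcapP/(_ (c x) isT); by rewrite !inE eqxx.
have s_le : \sum_i hit R h i <= 1 + eta.
  move: sum_ge; rewrite (eq_bigr _ (fun i _ => hitE i)) sumrB sumr_const card_ord.
  by lra.
have small' : 6 * ((2 * K + 1) * r%:R ^+ 2 * eta) <= 1.
  by apply: le_trans small; rewrite /C le_eqVlt; apply/orP; left; apply/eqP; ring.
have hT i D : h i (D :&: setT) = h i D by rewrite setIT.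
have [[k hk]|[x _ hx]] := const_or_star hr cov s_le small' hT.
- right; exists k; rewrite -/K in hk.
  have hit_le j : j != k -> hit R h j <= (K + 1) * eta.
    move=> jk; move: s_le; rewrite (bigD1 k) //= (bigD1 j) //=.
    have : 0 <= \sum_(l < r | (l != k) && (l != j)) hit R h l.
      by apply: sumr_ge0 => l _; apply: prob_ge0.
    by lra.
  have CK : (K + 1) * eta <= C * eta by rewrite ler_wpM2r // ltW.
  split.
    split; first by rewrite hitE; lra.
    by move=> j /hit_le; rewrite hitE; lra.
  (* A second such index would give [A k] measure at least [1 - C * eta], against [C * eta] and
     [2 * C * eta < 1]. *)
  move=> i [Ai oth]; apply/eqP; apply: contraT => ki.
  have := oth k ki; rewrite hitE; lra.
- left; exists x => i; rewrite (biased_measure_prob R _ i).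
  (* Both [h i] and the star are complemented here, so the disagreement event is the symmetric
     difference. *)
  apply: le_trans (hx i); rewrite le_eqVlt; apply/orP; left; apply/eqP.
  apply: eq_prob => c; rewrite /symdiff /star /h !inE.
  by case: (_ \in A i); case: (c x == i).
Qed.
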